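(* Let $R_1,\dots,R_n$ be finitely many commutative rings with identity. Then there is a homeomorphism $$\mathrm{Max}\left(\prod_{i=1}^n R_i\right)\cong\bigoplus_{i=1}^n\mathrm{Max}(R_i).$$
   Context: For a commutative ring $R$ with identity, $\mathrm{Max}(R)$ is the set of maximal ideals of $R$ with the Zariski (hull-kernel) topology, whose closed sets are the sets $\{M\in\mathrm{Max}(R): S\subseteq M\}$ for $S\subseteq R$. $\bigoplus_{i} X_i$ denotes the disjoint union (topological sum) of the topological spaces $X_i$. *)

(* Defs.v *)
From HB Require Import structures.
From mathcomp Require Import all_boot all_order all_algebra.
From mathcomp Require Import all_classical topology.

Set Implicit Arguments.
Unset Strict Implicit.
Unset Printing Implicit Defensive.

Import GRing.Theory.
Local Open Scope classical_set_scope.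
Local Open Scope ring_scope.

(* ssralg equips only the non-dependent {ffun I -> R} with a ring structure. *)
Section ProductRing.
Variables (I : finType) (R : I -> comPzRingType).
Local Notation prodR := {dffun forall i : I, R i}.

Definition dffun_zero : prodR := [ffun i => 0].
Definition dffun_one : prodR := [ffun i => 1].
Definition dffun_opp (x : prodR) : prodR := [ffun i => - x i].
Definition dffun_add (x y : prodR) : prodR := [ffun i => x i + y i].
Definition dffun_mul (x y : prodR) : prodR := [ffun i => x i * y i].

Fact dffun_addA : associative dffun_add.
Proof. by move=> x y z; apply/ffunP => i; rewrite !ffunE addrA. Qed.
Fact dffun_addC : commutative dffun_add.
Proof. by move=> x y; apply/ffunP => i; rewrite !ffunE addrC. Qed.
Fact dffun_add0 : left_id dffun_zero dffun_add.
Proof. by move=> x; apply/ffunP => i; rewrite !ffunE add0r. Qed.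
Fact dffun_addN : left_inverse dffun_zero dffun_opp dffun_add.
Proof. by move=> x; apply/ffunP => i; rewrite !ffunE addNr. Qed.
Fact dffun_mulA : associative dffun_mul.
Proof. by move=> x y z; apply/ffunP => i; rewrite !ffunE mulrA. Qed.
Fact dffun_mulC : commutative dffun_mul.
Proof. by move=> x y; apply/ffunP => i; rewrite !ffunE mulrC. Qed.
Fact dffun_mul1 : left_id dffun_one dffun_mul.
Proof. by move=> x; apply/ffunP => i; rewrite !ffunE mul1r. Qed.
Fact dffun_mulD : left_distributive dffun_mul dffun_add.
Proof. by move=> x y z; apply/ffunP => i; rewrite !ffunE mulrDl. Qed.

HB.instance Definition _ := GRing.isZmodule.Build prodR
  dffun_addA dffun_addC dffun_add0 dffun_addN.
HB.instance Definition _ := GRing.Zmodule_isComPzRing.Build prodR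
  dffun_mulA dffun_mulC dffun_mul1 dffun_mulD.

End ProductRing.

Section MaximalIdeals.
Variable R : comPzRingType.
Implicit Types (I J : set R) (a x y : R).

(* The ideals of ring_quotient are decidable predicates on nontrivial rings;
   arbitrary subsets of a possibly zero ring are needed here. *)
Definition is_ideal I : Prop :=
  [/\ I 0, forall x y, I x -> I y -> I (x + y) & forall a x, I x -> I (a * x)].

Definition is_maximal_ideal I : Prop :=
  [/\ is_ideal I, I <> setT
    & forall J, is_ideal J -> I `<=` J -> J = I \/ J = setT].

Record Max : Type := MkMax {
  ideal_of :> set R;
  ideal_ofP : is_maximal_ideal ideal_of
}.

HB.instance Definition _ := gen_eqMixin Max.
HB.instance Definition _ := gen_choiceMixin Max.

Definition hull (S : set R) : set Max := [set M : Max | S `<=` M].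

Definition zariski_open (U : set Max) : Prop :=
  exists S : set R, ~` U = hull S.

Lemma ideal_eqT I : is_ideal I -> I 1 -> I = setT.
Proof.
move=> [_ _ IM] I1; apply/seteqP; split=> // x _.
by rewrite -[x]mulr1; exact: IM.
Qed.

Lemma max_notin1 (M : Max) : ~ ideal_of M 1.
Proof. by case: M => /= M [iM MT _] /(ideal_eqT iM). Qed.

Lemma max_prime (M : Max) x y :
  ideal_of M (x * y) -> ideal_of M x \/ ideal_of M y.
Proof.
move=> Mxy; have [Mx|nMx] := pselect (ideal_of M x); [by left|right].
have [iM _ maxM] := ideal_ofP M; have [M0 MD MM] := iM.
pose J : set R := [set z | exists m a, ideal_of M m /\ z = m + a * x].
have iJ : is_ideal J.
  split.
  - by exists 0, 0; rewrite mul0r addr0.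
  - move=> _ _ [m [a [Mm ->]]] [m' [a' [Mm' ->]]].
    by exists (m + m'), (a + a'); rewrite mulrDl addrACA; split=> //; exact: MD.
  - move=> b _ [m [a [Mm ->]]].
    by exists (b * m), (b * a); rewrite mulrDr mulrA; split=> //; exact: MM.
have MJ : M `<=` J by move=> m Mm; exists m, 0; rewrite mul0r addr0.
have Jx : J x by exists 0, 1; rewrite add0r mul1r.
case: (maxM J iJ MJ) => [JM|JT]; first by case: nMx; rewrite -JM.
have [m [a [Mm m1]]] : J 1 by rewrite JT.
rewrite -[y]mul1r m1 mulrDl -mulrA; apply: (MD); last exact: MM.
by rewrite mulrC; exact: MM.
Qed.

Fact zariski_openT : zariski_open setT.
Proof.
exists setT; rewrite setCT; apply/seteqP; split=> // M /= /(_ 1 I).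
exact: max_notin1.
Qed.

Fact zariski_openI : setI_closed zariski_open.
Proof.
move=> U V [S US] [T VT].
exists [set z | exists s t, [/\ S s, T t & z = s * t]].
rewrite setCI US VT; apply/seteqP; split=> [M [SM|TM] _ [s [t [Ss Tt ->]]]|M STM].
- by have [[_ _ MM] _ _] := ideal_ofP M; rewrite mulrC; apply/MM/SM.
- by have [[_ _ MM] _ _] := ideal_ofP M; apply/MM/TM.
have [SM|/existsNP[s /not_implyP[Ss nMs]]] := pselect (hull S M); first by left.
right=> t Tt; have /max_prime[//|//] : ideal_of M (s * t).
by apply: STM; exists s, t.
Qed.

Fact zariski_open_bigU (K : Type) (f : K -> set Max) :
  (forall k, zariski_open (f k)) -> zariski_open (\bigcup_k f k).
Proof.
move=> /choice[S fS]; exists (\bigcup_k S k).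
rewrite setC_bigcup; apply/seteqP; split=> [M fM x [k _ Skx]|M SM k _].
  by have := fM k I; rewrite fS; apply.
by rewrite fS => x Skx; apply: SM; exists k.
Qed.

HB.instance Definition _ := isOpenTopological.Build Max
  zariski_openT zariski_openI zariski_open_bigU.

Lemma zariski_closedP (C : set Max) : closed C <-> exists S, C = hull S.
Proof.
rewrite -openC.
have -> : open (~` C) = zariski_open (~` C) by [].
by rewrite /zariski_open setCK.
Qed.

End MaximalIdeals.

Definition homeomorphic (X Y : topologicalType) : Prop :=
  exists (f : X -> Y) (g : Y -> X),
    [/\ cancel f g, cancel g f, continuous f & continuous g].

(* Main.v *)
Require Import Defs.
From HB Require Import structures.
From mathcomp Require Import all_boot all_algebra all_classical unstable topology.

(** A surjective ring morphism [f : A -> B] identifies [Max B], by taking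
    preimages, with the closed subspace of [Max A] formed by the maximal ideals
    that contain [ker f]: the preimage map is injective and continuous, and it
    is closed because the image of [hull S] is the hull of the preimage of
    [0 |` S] ([contraction_hull]).

    For the coordinate projections of a finite product, these closed subspaces
    cover the spectrum and are disjoint.  They cover it because a maximal ideal
    [P] is prime: if [P] contained no kernel, a product over [i] of elements of
    [ker (proj i)] lying outside [P] would lie outside [P], although all its
    coordinates vanish ([prod_max_ker]).  They are disjoint because two distinct
    kernels are comaximal ([contraction_proj_neq]).

    Hence the preimage maps glue to a bijection from the topological sum onto
    the spectrum of the product.  It is continuous because each of its
    restrictions is, and closed because a finite union of closed sets is closed;
    so its inverse is continuous. *)

Set Implicit Arguments.
Unset Strict Implicit.
Unset Printing Implicit Defensive.

Import GRing.Theory.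
Local Open Scope classical_set_scope.
Local Open Scope ring_scope.

(** The record [Max] stores a proof, hence equality of maximal ideals as sets
    needs proof irrelevance to become equality in [Max]. *)
Lemma ideal_of_inj (A : comPzRingType) (M N : Max A) :
  ideal_of M = ideal_of N -> M = N.
Proof.
by case: M N => [M hM] [N hN] /= MN; subst N; rewrite (Prop_irrelevance hM hN).
Qed.

Section Contraction.
Variables (A B : comPzRingType) (f : {rmorphism A -> B}).
Hypothesis fsurj : forall y, exists x, f x = y.
Implicit Types (I : set A) (J : set B).

Lemma preimage_ideal J : is_ideal J -> is_ideal (f @^-1` J).
Proof.
move=> [J0 JD JM]; split=> [|x y Jx Jy|a x Jx] /=; first by rewrite rmorph0.
  by rewrite rmorphD; exact: JD.
by rewrite rmorphM; exact: JM.
Qed.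

Lemma image_ideal I : is_ideal I -> is_ideal (f @` I).
Proof.
move=> [I0 ID IM]; split.
- by exists 0 => //; rewrite rmorph0.
- move=> _ _ [x Ix <-] [y Iy <-].
  by exists (x + y); [exact: ID|rewrite rmorphD].
- move=> b _ [x Ix <-]; have [a <-] := fsurj b.
  by exists (a * x); [exact: IM|rewrite rmorphM].
Qed.

Lemma preimage_surj J : f @` (f @^-1` J) = J.
Proof.
apply/seteqP; split=> [_ [x Jx <-] //|y Jy].
by have [x fx] := fsurj y; exists x => //=; rewrite fx.
Qed.

(** If [f x = f y] with [y] in [I], then [x - y] lies in the kernel, hence
    in [I]. *)
Lemma image_saturated I :
  is_ideal I -> (forall x, f x = 0 -> I x) -> f @^-1` (f @` I) = I.
Proof.
move=> [_ ID _] kerI; apply/seteqP; split=> [x [y Iy fyx]|x Ix]; last by exists x.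
by rewrite -(subrK y x); apply: ID => //; apply: kerI; rewrite rmorphB fyx subrr.
Qed.

(** An ideal [I] above [f @^-1` J] contains the kernel, so it is determined by
    its image, an ideal above [J]. *)
Lemma preimage_maximal J : is_maximal_ideal J -> is_maximal_ideal (f @^-1` J).
Proof.
move=> [iJ JT maxJ]; have [J0 _ _] := iJ.
split; first exact: preimage_ideal.
  move=> fJT; apply: JT; rewrite -(preimage_surj J) fJT.
  by apply/seteqP; split=> // y _; have [x fx] := fsurj y; exists x.
move=> I iI JI.
have fI : f @^-1` (f @` I) = I.
  by apply: image_saturated => // x fx0; apply: JI; rewrite /= fx0.
have JfI : J `<=` f @` I by rewrite -{1}(preimage_surj J); exact: image_subset.
case: (maxJ _ (image_ideal iI) JfI) => E; [left|right]; by rewrite -fI E.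
Qed.

Lemma image_maximal I : is_maximal_ideal I -> (forall x, f x = 0 -> I x) ->
  is_maximal_ideal (f @` I).
Proof.
move=> [iI IT maxI] kerI; split; first exact: image_ideal.
  by move=> fIT; apply: IT; rewrite -(image_saturated iI kerI) fIT.
move=> J iJ fIJ.
have IJ : I `<=` f @^-1` J by move=> x Ix; apply: fIJ; exists x.
case: (maxI _ (preimage_ideal iJ) IJ) => E; [left|right].
  by rewrite -(preimage_surj J) E.
apply/seteqP; split=> // y _; have [x <-] := fsurj y.
by have : (f @^-1` J) x by rewrite E.
Qed.

Definition contraction (M : Max B) : Max A := MkMax (preimage_maximal (ideal_ofP M)).

Lemma contraction_inj : injective contraction.
Proof.
move=> M N /(congr1 (@ideal_of A)) /= E; apply: ideal_of_inj.
by rewrite -(preimage_surj M) E preimage_surj.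
Qed.

Lemma contraction_onto (P : Max A) :
  (forall x, f x = 0 -> ideal_of P x) -> exists M, contraction M = P.
Proof.
move=> kerP; have [iP _ _] := ideal_ofP P.
exists (MkMax (image_maximal (ideal_ofP P) kerP)).
by apply: ideal_of_inj; exact: image_saturated.
Qed.

(** Adding [0] to [S] puts the kernel in the preimage, which restricts its hull
    to the image of [contraction]. *)
Lemma contraction_hull (S : set B) :
  contraction @` hull S = hull (f @^-1` (0 |` S)).
Proof.
apply/seteqP; split=> [_ [M SM <-] x /= [->|Sfx]|P SP].
- by have [[]] := ideal_ofP M.
- exact: SM.
have [|M MP] := contraction_onto (P := P).
  by move=> x fx0; apply: SP; left.
exists M => // y Sy; have [x fx] := fsurj y.
have : ideal_of (contraction M) x by rewrite MP; apply: SP; right; rewrite fx.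
by rewrite /= fx.
Qed.

Lemma contraction_closed (C : set (Max B)) :
  closed C -> closed (contraction @` C).
Proof.
move=> /zariski_closedP[S ->]; apply/zariski_closedP.
by eexists; exact: contraction_hull.
Qed.

Lemma contraction_continuous : continuous contraction.
Proof.
apply/continuous_closedP => _ /zariski_closedP[S ->].
apply/zariski_closedP; exists (f @` S); apply/seteqP; split=> M /= SM.
  by move=> _ [x Sx <-]; exact: SM.
by move=> x Sx; apply: SM; exists x.
Qed.

End Contraction.

Section Projections.
Variables (I : finType) (R : I -> comPzRingType).
Local Notation prodR := {dffun forall i : I, R i}.

Definition dffun_proj (i : I) (x : prodR) : R i := x i.

Lemma dffun_proj_is_zmod_morphism i : zmod_morphism (dffun_proj i).
Proof. by move=> x y; rewrite /dffun_proj !ffunE. Qed.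

Lemma dffun_proj_is_monoid_morphism i : monoid_morphism (dffun_proj i).
Proof. by split=> [|x y]; rewrite /dffun_proj ffunE. Qed.

HB.instance Definition _ i := GRing.isZmodMorphism.Build prodR (R i)
  (dffun_proj i) (dffun_proj_is_zmod_morphism i).
HB.instance Definition _ i := GRing.isMonoidMorphism.Build prodR (R i)
  (dffun_proj i) (dffun_proj_is_monoid_morphism i).

Definition dffun_single i (r : R i) : prodR :=
  finfun (eqtype.dfwith (T := R) (fun j => 0) r).

Lemma dffun_proj_single i (r : R i) : dffun_proj i (dffun_single r) = r.
Proof. by rewrite /dffun_proj ffunE dfwith_in. Qed.

Lemma dffun_proj_single_neq i j (r : R i) :
  i != j -> dffun_proj j (dffun_single r) = 0.
Proof. by move=> ij; rewrite /dffun_proj ffunE dfwith_out. Qed.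

Lemma dffun_proj_surj i (r : R i) : exists x, dffun_proj i x = r.
Proof. by exists (dffun_single r); exact: dffun_proj_single. Qed.

(** Primality of [P], applied to a product with one factor in each kernel:
    such a product is zero.  Finiteness of [I] enters here. *)
Lemma prod_max_ker (P : Max prodR) :
  exists i, forall x, dffun_proj i x = 0 -> ideal_of P x.
Proof.
apply: contrapT => /forallNP nker.
have /choice[k kP] : forall i, exists x : prodR, x i = 0 /\ ~ ideal_of P x.
  by move=> i; have /existsNP[x /not_implyP[? ?]] := nker i; exists x.
have : ~ ideal_of P (\prod_i k i).
  elim/big_ind: _ => [|x y Px Py /max_prime[]//|i _]; first exact: max_notin1.
  by have [] := kP i.
apply; have -> : \prod_i k i = 0; last by have [[]] := ideal_ofP P.
apply/ffunP => i; rewrite (bigD1 i) //= !ffunE.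
by have [-> _] := kP i; rewrite mul0r.
Qed.

Definition contraction_proj i : Max (R i) -> Max prodR :=
  contraction (@dffun_proj_surj i).

(** The idempotent [e] supported at [i] and [1 - e] lie in the kernels of the
    projections at [j] and [i], so that no proper ideal contains both. *)
Lemma contraction_proj_neq i j (M : Max (R i)) (N : Max (R j)) :
  i != j -> contraction_proj M <> contraction_proj N.
Proof.
move=> ij MN; pose e := dffun_single (1 : R i).
have [[M0 _ _] _ _] := ideal_ofP M; have [[N0 _ _] _ _] := ideal_ofP N.
have Pe : ideal_of (contraction_proj N) e.
  by rewrite /= /preimage /= dffun_proj_single_neq.
have Pe' : ideal_of (contraction_proj N) (1 - e).
  by rewrite -MN /= /preimage /= rmorphB rmorph1 /= dffun_proj_single subrr.
have [[_ PD _] _ _] := ideal_ofP (contraction_proj N).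
by apply: (@max_notin1 _ (contraction_proj N)); rewrite -(subrK e 1); exact: PD.
Qed.

Definition max_glue : {i : I & Max (R i)} -> Max prodR :=
  sigT_fun contraction_proj.

Lemma max_glue_inj : injective max_glue.
Proof.
move=> [i M] [j N]; rewrite /max_glue /sigT_fun /= => MN.
have [ij|/contraction_proj_neq/(_ MN)//] := eqVneq i j.
by subst j; rewrite (contraction_inj MN).
Qed.

Lemma max_glue_onto P : exists s, max_glue s = P.
Proof.
have [i kerP] := prod_max_ker P.
by have [M MP] := contraction_onto (@dffun_proj_surj i) kerP; exists (existT _ i M).
Qed.

Lemma max_glue_continuous : continuous max_glue.
Proof. by apply: sigT_continuous => i; exact: contraction_continuous. Qed.

Lemma max_glue_closed (C : set {i : I & Max (R i)}) :
  closed C -> closed (max_glue @` C).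
Proof.
move=> cC; have -> : max_glue @` C =
    \bigcup_i (@contraction_proj i @` (existT _ i @^-1` C)).
  apply/seteqP; split=> [_ [[i M] CM <-]|_ [i _ [M CM <-]]].
    by exists i => //; exists M.
  by exists (existT _ i M).
apply: closed_bigcup => [|i _]; first exact: finite_finset.
apply: contraction_closed; apply: closed_comp => // M _.
exact: existT_continuous.
Qed.

Lemma homeomorphic_Max_prod :
  homeomorphic (Max prodR) {i : I & Max (R i)}.
Proof.
have /choice[g gK] := max_glue_onto.
have Kg : cancel max_glue g by move=> s; apply: max_glue_inj; rewrite gK.
exists g, max_glue; split=> //; last exact: max_glue_continuous.
apply/continuous_closedP => C cC.
have -> : g @^-1` C = max_glue @` C; last exact: max_glue_closed.
apply/seteqP; split=> [P CgP|_ [s Cs <-]]; last by rewrite /= Kg.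
by exists (g P).
Qed.

End Projections.

Theorem corollary4p9 (n : nat) (R : 'I_n -> comPzRingType) :
  homeomorphic (Max {dffun forall i : 'I_n, R i}) {i : 'I_n & Max (R i)}.
Proof. exact: homeomorphic_Max_prod. Qed.
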